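(* Let $I=\langle x^{a_i}y^{b_i}\mid 0\le i\le r\rangle$ be a monomial ideal of $R$ with $r\ge 2$, $a_0>a_1>\dots>a_{r-1}>a_r=0$, $b_0=0<b_1<\dots<b_{r-1}<b_r$ and $a_0\le b_r$. Let $M=M(I;e)$ where $2\le e\le r-1$. If $I(M)$ is complete, then $M$ is an indecomposable integrally closed $R$-module.
   Context: $(R,\mathfrak m)$ is a two-dimensional regular local ring with infinite residue field, and $x,y$ is a fixed regular system of parameters, $\mathfrak m=\langle x,y\rangle$. An ideal is complete if it is integrally closed. The module $M(I;e)$: for $I$ as in the claim and $2\le e\le r$, put $a_i'=a_i-e+1$ for $0\le i\le r-e+1$ and $c_i=b_{r-e+1+i}-i$ for $1\le i\le e-1$. Let $\epsilon_1,\dots,\epsilon_e$ be the standard basis of $R^e$. Then $M(I;e)\subset F:=R^e$ is the submodule generated by $f_i=x^{a_i'}y^{b_i}\epsilon_1$ for $0\le i\le r-e+1$, $g_i=y\,\epsilon_i+x\,\epsilon_{i+1}$ for $1\le i\le e-1$, $h_i=y^{c_i}\epsilon_{i+1}$ for $1\le i\le e-1$. For a finitely generated torsion-free $R$-module $M$, the double dual $M^{**}$ is free and contains $M$ with finite-length quotient; $I(M)=\operatorname{Fitt}_0(M^{**}/M)$. (For $M=M(I;e)$ one has $M^{**}=R^e$, so $I(M)$ is the ideal generated by the maximal minors of the matrix whose columns are $f_0,\dots,f_{r-e+1},g_1,\dots,g_{e-1},h_1,\dots,h_{e-1}$.) Integral closure of modules (Rees): with $K$ the fraction field of $R$, $M_K=M\otimes_R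 K$, and $MV$ the image of $M\otimes_R V\to M_K$ for $R\subset V\subset K$, set $\overline M=\{f\in M_K\mid f\in MV$ for every discrete valuation ring $V$ with $R\subset V\subset K\}$; $M$ is integrally closed if $\overline M=M$. *)

(* Defs.v *)
From HB Require Import structures.
From mathcomp Require Import all_boot all_order all_algebra.
From mathcomp Require Import fraction boolp classical_sets.

Set Implicit Arguments.
Unset Strict Implicit.
Unset Printing Implicit Defensive.
Import Order.TTheory GRing.Theory Num.Theory.
Local Open Scope classical_set_scope.
Local Open Scope ring_scope.

(* [A] is meant to be a subring of the ring of scalars [K].                   *)

Definition is_submod (K : nzRingType) (W : lmodType K) (A : set K)
    (N : set W) : Prop :=
  [/\ N 0,
      forall u v, N u -> N v -> N (u + v) &
      forall a u, A a -> N u -> N (a *: u)].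

Definition mspan (K : nzRingType) (W : lmodType K) (A : set K) (S : set W) :
  set W := smallest (is_submod A) S.

Definition is_ideal (R : comNzRingType) (J : set R) : Prop :=
  @is_submod R R^o setT J.

Definition ideal_gen (R : comNzRingType) (S : set R) : set R :=
  @mspan R R^o setT S.

Definition noetherian (R : comNzRingType) : Prop :=
  forall J : set R, is_ideal J -> exists s : seq R, J = ideal_gen [set` s].

Definition prime_ideal (R : comNzRingType) (P : set R) : Prop :=
  [/\ is_ideal P, ~ P 1 & forall u v, P (u * v) -> P u \/ P v].

Definition maximal_ideal (R : comNzRingType) (m : set R) : Prop :=
  [/\ is_ideal m, ~ m 1 &
      forall J : set R, is_ideal J -> ~ J 1 -> m `<=` J -> J = m].

Definition has_prime_chain (R : comNzRingType) (n : nat) : Prop :=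
  exists P : nat -> set R,
    (forall i, (i <= n)%N -> prime_ideal (P i)) /\
    (forall i, (i < n)%N -> P i `<` P i.+1).

Definition krull_dim (R : comNzRingType) (n : nat) : Prop :=
  has_prime_chain R n /\ ~ has_prime_chain R n.+1.

Definition local_ring (R : comNzRingType) (m : set R) : Prop :=
  maximal_ideal m /\ forall m' : set R, maximal_ideal m' -> m' = m.

(* [R] is a regular local ring of dimension [d], with maximal ideal [m] and   *)
(* regular system of parameters [t].                                          *)
Definition regular_local (R : comNzRingType) (m : set R) (d : nat)
    (t : d.-tuple R) : Prop :=
  [/\ noetherian R, local_ring m, krull_dim R d & m = ideal_gen [set` t]].

(* Finitely many elements never represent all the classes of R/m.             *)
Definition infinite_residue_field (R : comNzRingType) (m : set R) : Prop :=
  forall s : seq R, exists u : R, forall v, v \in s -> ~ m (u - v).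

Section FractionField.
Variable R : idomainType.
Local Notation K := {fraction R}.
Local Notation toK := (@tofrac R).

Definition Rsub : set K := range toK.

Definition extK n (M : set 'rV[R]_n) : set 'rV[K]_n :=
  [set map_mx toK u | u in M].

Definition discrete_valuation (v : K -> int) : Prop :=
  [/\ forall f g : K, f != 0 -> g != 0 -> v (f * g) = v f + v g,
      forall f g : K, f != 0 -> g != 0 -> f + g != 0 ->
        Num.min (v f) (v g) <= v (f + g) &
      exists2 t : K, t != 0 & v t = 1].

(* Discrete valuation rings V with R <= V <= K; the field of fractions of     *)
(* such a V is K.                                                             *)
Definition dvr_over (V : set K) : Prop :=
  Rsub `<=` V /\
  exists2 v, discrete_valuation v & V = [set f | f = 0 \/ 0 <= v f].

(* Since K is flat over R, M_K is the K-span of M in K^n, and MV is the       *)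
(* V-span.                                                                    *)
Definition int_closure n (M : set 'rV[R]_n) : set 'rV[K]_n :=
  [set f | mspan setT (extK M) f /\
           forall V, dvr_over V -> mspan V (extK M) f].

Definition integrally_closed n (M : set 'rV[R]_n) : Prop :=
  int_closure M = extK M.

(* Complete means integrally closed as a submodule of R = R^1: J contains     *)
(* every f in K lying in JV for all the discrete valuation rings V.           *)
Definition complete_ideal (J : set R) : Prop :=
  integrally_closed [set u : 'rV[R]_1 | J (u ord0 ord0)].

(* For N spanning K^n, a linear form N -> R extends uniquely to K^n, so       *)
(* N^* is identified with a submodule of K^n through the dot product.         *)
Definition dual n (N : set 'rV[K]_n) : set 'rV[K]_n :=
  [set p | forall u, N u -> Rsub ((p *m u^T) ord0 ord0)].

Definition ddual n (M : set 'rV[R]_n) : set 'rV[K]_n := dual (dual (extK M)).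

(* Fitt_0 of (R-span of the rows of U) / N: the rows of C are the relations   *)
(* modulo N between the k generators given by the rows of U.                  *)
Definition fitt0 k n (U : 'M[K]_(k, n)) (N : set 'rV[K]_n) : set R :=
  ideal_gen [set \det C | C in
    [set C : 'M[R]_k | forall i, N (row i (map_mx toK C *m U))]].

Definition free_basis n (B : 'M[K]_n) (N : set 'rV[K]_n) : Prop :=
  B \in unitmx /\ N = mspan Rsub (range (fun i => row i B)).

(* I(M) = Fitt_0(M^** / M) for M of rank n in R^n; the value does not depend  *)
(* on the basis of the free module M^**.                                      *)
Definition IM n (M : set 'rV[R]_n) : set R :=
  [set s | exists2 B, free_basis B (ddual M) & fitt0 B (extK M) s].

Definition indecomposable n (M : set 'rV[R]_n) : Prop :=
  M <> [set 0] /\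
  forall N1 N2 : set 'rV[R]_n,
    is_submod setT N1 -> is_submod setT N2 ->
    M = [set u + w | u in N1 & w in N2] -> N1 `&` N2 = [set 0] ->
    N1 = [set 0] \/ N2 = [set 0].

(* Standard basis of R^e, numbered from 1.                                    *)
Definition eps (e k : nat) : 'rV[R]_e := \row_(j < e) (j.+1 == k)%:R.

(* The truncated subtractions are exact when 2 <= e <= r, a is strictly       *)
(* decreasing and b strictly increasing on 0..r; a_i' is written              *)
(* a_i - (e - 1) for this reason, as a_i may be equal to e - 1.               *)
Definition Mmod (x y : R) (r : nat) (a b : nat -> nat) (e : nat) :
    set 'rV[R]_e :=
  mspan setT
    ([set (x ^+ (a i - (e - 1)) * y ^+ b i) *: eps e 1
        | i in [set i : nat | (i <= r - e + 1)%N]] `|`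
     [set y *: eps e i + x *: eps e i.+1
        | i in [set i : nat | (1 <= i <= e - 1)%N]] `|`
     [set y ^+ (b (r - e + 1 + i)%N - i) *: eps e i.+1
        | i in [set i : nat | (1 <= i <= e - 1)%N]]).

End FractionField.

Arguments Mmod {R} x y r a b e _.

(* Main.v *)
Require Import Defs.
From mathcomp Require Import all_boot all_order all_algebra.
From mathcomp Require Import fingroup perm fraction boolp classical_sets.
From mathcomp Require Import ring zify.

(** Write n = e - 1, d = r - n, F = R^e, with coordinates numbered from 0 to n,
and let phi(u) = sum_k (-y)^k x^(n-k) u_k for u in F.  This linear form is the
determinant of the matrix with rows u, g_1, .., g_n [koszul_form_det].  As x, y
is a regular sequence, the kernel of phi on F is spanned by the g_i
[koszul_form_ker], and the g_i lie in M; hence M is the full preimage in F of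
the ideal J = phi(M).

The heart of the proof is the equality I(M) = J [IM_modM].  First, M contains
multiples of the standard basis by a power of x and by a power of y, so that
M^** = F and I(M) is generated by the determinants of e elements of M
[ddual_eq_lattice, IM_det, IM_sub].  The elements of J are such determinants.
Conversely, in a nonzero Leibniz term of a determinant of generators each g_i
is used at most once and gives y in column i - 1 or x in column i, and an
induction on the columns, from the last one, shows that the term is divisible by
one of the monomials x^(a_i) y^(b_i) = phi(f_i), for i <= d, and
x^(n-k) y^(b_(d+k)) = phi(h_k) up to sign [diagonal_suffix, diagonal_product].

M is integrally closed: let f be integral over M.  A linear form psi with
psi(M) in J maps f into the integral closure of J, which is J
[int_closure_form].  Taking for psi a coordinate multiplied by x^(a_0) or by
y^(b_r), both in J, one sees that the denominators of f divide a power of x and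
a power of y, so that f lies in F.  Taking psi = phi one gets phi(f) in J, and f
lies in M.

M is indecomposable: the projection onto a direct summand of M extends to
M^** = F, and is thus an idempotent matrix P with M P in M [projection_matrix].
Because e < r, the f_i and h_k lie in m^2 F.  So P maps each g_i into the span of
the g_i modulo m^2 F; a comparison of the coefficients of x and y shows that P
is modulo m a Toeplitz matrix whose first column vanishes below the diagonal
and whose last column vanishes above it, hence a scalar matrix
[modM_endomorphism_scalar].  By Nakayama's lemma an idempotent matrix that is
scalar modulo m is 0 or 1 [idempotent_scalar_mod].

That x, y is a regular sequence comes from the dimension of R.  If x were a zero
divisor modulo y, some power of x would be divisible by y [param_regular], and
then m would be minimal over yR; the argument of Krull's principal ideal theorem
shows that this is impossible in dimension two [param_power_notin_principal]. *)

Set Implicit Arguments.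
Unset Strict Implicit.
Unset Printing Implicit Defensive.
Import Order.TTheory GRing.Theory Num.Theory.
Local Open Scope classical_set_scope.
Local Open Scope ring_scope.

(** * Spans and ideals *)

Section Spans.
Context (K : nzRingType) (W : lmodType K) (A : set K).
Implicit Types (S N : set W).

Lemma mspan_submod S : is_submod A (mspan A S).
Proof.
split.
- by move=> N [[N0 _ _] _].
- by move=> u v Su Sv N hN; have [_ ND _] := hN.1; apply: ND; [apply: Su|apply: Sv].
- by move=> a u Aa Su N hN; have [_ _ NZ] := hN.1; apply: NZ => //; apply: Su.
Qed.

Lemma mspan_gen S u : S u -> mspan A S u.
Proof. exact: (@sub_gen_smallest _ (is_submod A) S u). Qed.

Lemma mspan_min S N : is_submod A N -> S `<=` N -> mspan A S `<=` N.
Proof. exact: (@smallest_sub _ (is_submod A) S N). Qed.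

Lemma submod_sum N (I : finType) (F : I -> W) : is_submod A N ->
  (forall i, N (F i)) -> N (\sum_i F i).
Proof. by case=> N0 ND _ h; elim/big_ind: _. Qed.

End Spans.

Lemma mspan_linear (K : nzRingType) (W W' : lmodType K) (A : set K)
    (f : {linear W -> W'}) (S : set W) (S' : set W') :
  (forall u, S u -> mspan A S' (f u)) ->
  forall u, mspan A S u -> mspan A S' (f u).
Proof.
move=> h; apply: mspan_min => //.
have [h0 hD hZ] := mspan_submod A S'; split.
- by rewrite linear0.
- by move=> u v hu hv; rewrite linearD; apply: hD.
- by move=> a u Aa hu; rewrite linearZ; apply: hZ.
Qed.

Section Ideals.
Context (R : comNzRingType).
Implicit Types (J Q m : set R).

Lemma ideal0 J : is_ideal J -> J 0. Proof. by case. Qed.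
Lemma idealD J u v : is_ideal J -> J u -> J v -> J (u + v).
Proof. by case=> _ h _; apply: h. Qed.
Lemma idealM J a u : is_ideal J -> J u -> J (a * u).
Proof. by case=> _ _ h; apply: (h a u I). Qed.
Lemma ideal_mulr J a u : is_ideal J -> J u -> J (u * a).
Proof. by rewrite mulrC; apply: idealM. Qed.
Lemma idealN J u : is_ideal J -> J u -> J (- u).
Proof. by move=> hJ h; rewrite -mulN1r; apply: idealM. Qed.
Lemma idealB J u v : is_ideal J -> J u -> J v -> J (u - v).
Proof. by move=> hJ hu hv; apply: idealD => //; apply: idealN. Qed.
Lemma ideal_sum J (I : finType) (F : I -> R) : is_ideal J ->
  (forall i, J (F i)) -> J (\sum_i F i).
Proof. exact: (@submod_sum R R^o). Qed.

Lemma mk_ideal J : J 0 -> (forall u v, J u -> J v -> J (u + v)) ->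
  (forall a u, J u -> J (a * u)) -> is_ideal J.
Proof. by move=> h0 hD hM; split => // a u _; apply: hM. Qed.

Lemma ideal_gen_ideal (S : set R) : is_ideal (ideal_gen S).
Proof. exact: (@mspan_submod R R^o). Qed.

Lemma ideal_genE (s : seq R) u :
  ideal_gen [set` s] u <-> exists c : 'I_(size s) -> R, u = \sum_i c i * s`_i.
Proof.
split; last first.
  case=> c ->; apply: (ideal_sum (ideal_gen_ideal _)) => i.
  apply: (idealM _ (ideal_gen_ideal _)).
  by apply: (@mspan_gen R R^o) => /=; rewrite mem_nth.
apply: (@mspan_min R R^o setT _ [set u | exists c : 'I_(size s) -> R, u = \sum_i c i * s`_i]).
  apply: mk_ideal.
  - by exists (fun=> 0); rewrite big1 // => i _; rewrite mul0r.
  - move=> _ _ [c1 ->] [c2 ->]; exists (fun i => c1 i + c2 i).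
    by rewrite -big_split; apply: eq_bigr => i _; rewrite mulrDl.
  - move=> a _ [c ->]; exists (fun i => a * c i).
    by rewrite mulr_sumr; apply: eq_bigr => i _; rewrite mulrA.
move=> v /= vs; have lt : (index v s < size s)%N by rewrite index_mem.
exists (fun i => (i == Ordinal lt)%:R).
rewrite (bigD1 (Ordinal lt)) //= eqxx mul1r nth_index // big1 ?addr0 // => i /negbTE ->.
by rewrite mul0r.
Qed.

Lemma ideal_gen2E (x y u : R) :
  ideal_gen [set` [tuple x; y]] u <-> exists p q, u = p * x + q * y.
Proof.
rewrite (_ : [set` [tuple x; y]] = [set` [:: x; y]]); last first.
  by apply/seteqP; split.
rewrite ideal_genE; split.
  by case=> c ->; rewrite !big_ord_recl big_ord0 /= addr0; do 2!eexists.
case=> p [q ->]; exists (fun i => if i == ord0 then p else q).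
by rewrite !big_ord_recl big_ord0 /= addr0.
Qed.

(** The ideal of multiples of a nonunit lies, by Zorn's lemma, in a maximal
ideal, and there is only one. *)
Lemma notin_maximal_unit m u : local_ring m -> ~ m u -> exists w, u * w = 1.
Proof.
move=> [_ um] mu; apply: contrapT => nu.
pose P (B : set R) := [/\ is_ideal B, ~ B 1 & B u].
have [] := @Zorn_bigcup R [set B : set R | B = set0 \/ P B].
  move=> F FP Ft; have [[C [FC PC]]|nC] := pselect (exists C, F C /\ P C); last first.
    left; apply/seteqP; split => // v [B FB Bv].
    have [B0|PB] := FP _ FB; first by rewrite B0 in Bv.
    by case: nC; exists B.
  (* The union of a chain is an ideal as soon as one member is nonempty; the
     empty set was admitted for the sake of the empty chain. *)
  right; split.
  - apply: mk_ideal.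
    + by exists C => //; apply: ideal0; case: PC.
    + move=> v w [B FB Bv] [D FD Dw].
      have hB : is_ideal B by case: (FP _ FB) => [B0|[]//]; rewrite B0 in Bv.
      have hD : is_ideal D by case: (FP _ FD) => [B0|[]//]; rewrite B0 in Dw.
      have [BD|DB] := Ft _ _ FB FD.
        by exists D => //; apply: idealD => //; apply: BD.
      by exists B => //; apply: idealD => //; apply: DB.
    + move=> c v [B FB Bv]; exists B => //; apply: idealM => //.
      by case: (FP _ FB) => [B0|[]//]; rewrite B0 in Bv.
  - by move=> [B FB B1]; have [B0|[]//] := FP _ FB; rewrite B0 in B1.
  - by exists C => //; case: PC.
move=> A [PA Amax].
pose U := [set v | exists w, v = u * w].
have PU : P U.
  split.
  - apply: mk_ideal; first by exists 0; rewrite mulr0.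
    + by move=> _ _ [v ->] [w ->]; exists (v + w); rewrite mulrDr.
    + by move=> c _ [w ->]; exists (c * w); rewrite mulrCA.
  - by move=> [w hw]; apply: nu; exists w.
  - by exists 1; rewrite mulr1.
have {PA}[hA A1 Au] : P A.
  case: PA => // A0; exfalso; apply: (Amax U); last by right.
  by rewrite A0; split => // /(_ u) -[]; case: PU.
have mA : maximal_ideal A.
  split => // J hJ J1 AJ; apply/seteqP; split => //.
  apply: contrapT => nJA; apply: (Amax J); first by split.
  by right; split => //; apply: AJ.
by apply: mu; rewrite -(um _ mA).
Qed.

(** Sums and products preserve congruence modulo an ideal, and a determinant is
built from its entries by sums and products. *)
Lemma det_congr J n (A B : 'M[R]_n) : is_ideal J ->
  (forall i j, J (A i j - B i j)) -> J (\det A - \det B).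
Proof.
move=> hJ AB; rewrite /determinant.
apply: (big_ind2 (fun u v => J (u - v))) => [|u u' v v' h h'|s _].
- by rewrite subrr; apply: ideal0.
- by rewrite opprD addrACA; apply: idealD.
rewrite -mulrBr; apply: idealM => //.
apply: (big_ind2 (fun u v => J (u - v))) => [|u u' v v' h h'|i _] //.
- by rewrite subrr; apply: ideal0.
rewrite (_ : u * v - _ = v * (u - u') + u' * (v - v')); last by ring.
by apply: idealD => //; apply: idealM.
Qed.

Lemma det1B_unit m n (C : 'M[R]_n) : local_ring m -> (forall i j, m (C i j)) ->
  exists w, \det (1%:M - C) * w = 1.
Proof.
move=> hm hC; have [[im m1 _] _] := hm.
apply: notin_maximal_unit (hm) _ => h.
have h1 : m (\det (1%:M - C) - \det (1%:M : 'M[R]_n)).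
  apply: det_congr => // i j; rewrite !mxE addrAC subrr sub0r.
  exact: idealN.
apply: m1; rewrite (_ : 1 = \det (1%:M - C) - (\det (1%:M - C) - \det (1%:M : 'M[R]_n))).
  exact: idealB.
by rewrite det1; ring.
Qed.

(** Nakayama's lemma in matrix form: multiplication by the adjugate of 1 - C
turns (1 - C) v into a unit multiple of v. *)
Lemma nakayama m Q n (C : 'M[R]_n) (v : 'cV[R]_n) : local_ring m -> is_ideal Q ->
  (forall i j, m (C i j)) -> (forall i, Q ((v - C *m v) i 0)) ->
  forall i, Q (v i 0).
Proof.
move=> hm hQ hC hv i.
have [w hw] := det1B_unit hm hC.
have -> : v i 0 = w * (\adj (1%:M - C) *m (v - C *m v)) i 0.
  rewrite (_ : v - C *m v = (1%:M - C) *m v); last by rewrite mulmxBl mul1mx.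
  rewrite mulmxA mul_adj_mx mul_scalar_mx mxE.
  by rewrite mulrA [w * _]mulrC hw mul1r.
apply: idealM => //; rewrite mxE; apply: ideal_sum => // j.
exact: idealM.
Qed.

End Ideals.

(** * Regular sequences from the dimension *)

(** The second half of the condition that y, x is a regular sequence: x is not a
zero divisor modulo y. *)
Definition regular_pair (R : nzRingType) (x y : R) : Prop :=
  forall u v, x * u = y * v -> exists t, u = y * t.

Section TwoParameters.
Context (R : idomainType) (m : set R) (x y : R).
Hypothesis locm : local_ring m.
Hypothesis noeth : noetherian R.
Hypothesis mE : forall u, m u <-> exists p q, u = p * x + q * y.

Let im : is_ideal m. Proof. by have [[]] := locm. Qed.
Let mx : m x. Proof. by apply/mE; exists 1, 0; ring. Qed.
Let my : m y. Proof. by apply/mE; exists 0, 1; ring. Qed.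

(** The ideal m/(y) of R/(y) is generated by x, so the coefficient of x^k in an
expansion modulo y is either a unit or gives one more factor x. *)
Lemma expand_mod_param k u :
  (exists p q, u = p * x ^+ k + q * y) \/
  exists j w w' q, [/\ (j < k)%N, w * w' = 1 & u = w * x ^+ j + q * y].
Proof.
elim: k => [|k [[p [q uE]]|[j [w [w' [q [lt ww' uE]]]]]]].
- by left; exists u, 0; rewrite expr0; ring.
- have [mp|nmp] := pselect (m p).
    have /mE [p1 [q1 pE]] := mp.
    by left; exists p1, (q1 * x ^+ k + q); rewrite uE pE exprS; ring.
  have [w' pw'] := notin_maximal_unit locm nmp.
  by right; exists k, p, w', q.
- by right; exists j, w, w', q; split => //; apply: ltnW.
Qed.

(** By [expand_mod_param], an ideal containing y is determined by the least j
such that it contains x^j.  If y divides x^k, then j <= k, and a descending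
sequence of such ideals cannot decrease at every step.  Here this is applied to
the ideals Q n + (y). *)
Lemma descending_mod_param (k : nat) (t : R) (Q : nat -> set R) :
  x ^+ k = t * y -> (forall n, is_ideal (Q n)) ->
  exists n, forall u, Q n u -> exists v q, Q n.+1 v /\ u = v + q * y.
Proof.
move=> xk hQ.
pose D n := [set u | exists v q, Q n v /\ u = v + q * y].
have hD n : is_ideal (D n).
  apply: mk_ideal.
  - by exists 0, 0; split; [apply: ideal0 | ring].
  - move=> _ _ [v [q [h ->]]] [v' [q' [h' ->]]]; exists (v + v'), (q + q').
    by split; [apply: idealD | ring].
  - move=> c _ [v [q [h ->]]]; exists (c * v), (c * q).
    by split; [apply: idealM | ring].
have Dy n q : D n (q * y).
  by exists 0, q; split; [apply: ideal0 | rewrite add0r].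
have [[n hn]|nn] := pselect (exists n, forall j, D n (x ^+ j) -> D n.+1 (x ^+ j)).
  exists n => u Qu.
  have Du : D n u by exists u, 0; rewrite mul0r addr0.
  suff: D n.+1 u by [].
  have [[p [q uE]]|[j [w [w' [q [_ ww' uE]]]]]] := expand_mod_param k u.
    by rewrite uE xk mulrA -mulrDl; apply: Dy.
  rewrite uE; apply: idealD (Dy _ _) => //; apply: idealM => //.
  apply: hn; rewrite (_ : x ^+ j = w' * (u - q * y)).
    by apply: idealM => //; apply: idealB.
  by rewrite uE addrK mulrA [w' * w]mulrC ww' mul1r.
exfalso.
have step n : exists j, D n (x ^+ j) /\ ~ D n.+1 (x ^+ j).
  apply: contrapT => h; apply: nn; exists n => j Dj.
  by apply: contrapT => nDj; apply: h; exists j.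
have lower n : forall j, D n (x ^+ j) -> (n <= j)%N.
  elim: n => [//|n IH] j Dj; have [i [Di nDi]] := step n.
  apply: leq_ltn_trans (IH _ Di) _; rewrite ltnNge; apply/negP => ji; apply: nDi.
  by rewrite -(subnK ji) exprD; apply: idealM.
have := lower k.+1 k; rewrite ltnn; apply/not_implyP; split => //.
by rewrite xk; apply: Dy.
Qed.

(** The proof of Krull's principal ideal theorem, with the saturations
Q_n = (z^n : y^oo) in place of symbolic powers.  Since y is not a zero divisor
modulo Q_n, the inclusion of Q_n in Q_(n+1) + (y) gives Q_n = Q_(n+1) + y Q_n,
and Nakayama's lemma gives Q_n = Q_(n+1).  Then z^n lies in Q_(n+1), so z
divides a power of y, and y lies in P; but then P contains x and y. *)
Lemma param_power_notin_principal (P : set R) (z w : R) : prime_ideal P -> P z -> z != 0 ->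
  m w -> ~ P w -> forall k t, x ^+ k = t * y -> False.
Proof.
move=> [hP P1 Pp] Pz z0 mw Pw k t xk.
have PX u n : P (u ^+ n) -> P u.
  by elim: n => [/P1 //|n IH]; rewrite exprS => /Pp [].
have Py : ~ P y.
  move=> Py; apply: Pw; have /mE [p [q ->]] := mw.
  apply: idealD => //; apply: idealM => //.
  by apply: (PX _ k); rewrite xk; apply: idealM.
pose Q n := [set u | exists N c, y ^+ N * u = c * z ^+ n].
have hQ n : is_ideal (Q n).
  apply: mk_ideal.
  - by exists 0%N, 0; ring.
  - move=> u v [N [c h]] [N' [c' h']].
    exists (N + N')%N, (y ^+ N' * c + y ^+ N * c').
    by rewrite mulrDl -!mulrA -h -h' exprD; ring.
  - move=> p u [N [c h]]; exists N, (p * c).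
    by rewrite mulrCA h mulrA.
have [n hn] := descending_mod_param xk hQ.
have [s sE] := noeth (hQ n).
have Qs i : Q n s`_i.
  have [lt|ge] := ltnP i (size s); last by rewrite nth_default //; apply: ideal0.
  by rewrite sE; apply: (@mspan_gen R R^o) => /=; rewrite mem_nth.
have QSsub u : Q n.+1 u -> Q n u.
  by move=> [N [c h]]; exists N, (c * z); rewrite h exprS mulrA.
have /choice[c hc] (i : 'I_(size s)) :
    exists c : 'I_(size s) -> R, Q n.+1 (s`_i - y * \sum_j c j * s`_j).
  have [v [q [Qv sv]]] := hn _ (Qs i).
  suff /ideal_genE [c qE] : ideal_gen [set` s] q.
    by exists c; rewrite -qE sv [y * q]mulrC addrK.
  rewrite -sE.
  have [N [d]] : Q n (q * y).
    by rewrite (_ : q * y = s`_i - v); [apply: idealB => //; apply: QSsub | rewrite sv addrC addKr].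
  by move=> h; exists N.+1, d; rewrite -h exprSr; ring.
pose C := \matrix_(i, j) (y * c i j).
pose v := \col_(i < size s) s`_i.
have Qv : forall i, Q n.+1 (v i 0).
  apply: (@nakayama _ m _ _ C) => // i.
    by move=> j; rewrite mxE; apply: ideal_mulr.
  rewrite !mxE; have := hc i; rewrite mulr_sumr.
  by under eq_bigr do rewrite mulrA; under [in X in _ -> X]eq_bigr do rewrite !mxE.
have : Q n.+1 (z ^+ n).
  have : Q n (z ^+ n) by exists 0%N, 1; ring.
  rewrite sE => /ideal_genE [p ->]; apply: ideal_sum => // i; apply: idealM => //.
  by have := Qv i; rewrite mxE.
move=> [N [p]]; rewrite exprS mulrA => /(mulIf (expf_neq0 _ z0)) yN.
by apply: Py; apply: (PX _ N); rewrite yN; apply: idealM.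
Qed.

(** If x u = 0 in R/(y), write u = w x^j with w a unit: then x^(j+1) = 0.  Only a
u in all the ideals (x^N, y) escapes this; such a u vanishes modulo y, because
some single power x^N kills the x-power torsion of R/(y). *)
Lemma param_regular : (forall k t, x ^+ k = t * y -> False) -> regular_pair x y.
Proof.
move=> nopow u v xu.
pose J := [set s | exists N c, x ^+ N * s = c * y].
have hJ : is_ideal J.
  apply: mk_ideal.
  - by exists 0%N, 0; ring.
  - move=> s s' [N [c h]] [N' [c' h']].
    exists (N + N')%N, (x ^+ N' * c + x ^+ N * c').
    by rewrite mulrDl -!mulrA -h -h' exprD; ring.
  - move=> p s [N [c h]]; exists N, (p * c).
    by rewrite mulrCA h mulrA.
have [N hN] : exists N, forall s, J s -> exists c, x ^+ N * s = c * y.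
  have [s sE] := noeth hJ.
  have /choice[N hN] (i : 'I_(size s)) : exists N, exists c, x ^+ N * s`_i = c * y.
    suff [N [c h]] : J s`_i by exists N, c.
    by rewrite sE; apply: (@mspan_gen R R^o) => /=; rewrite mem_nth.
  exists (\max_i N i); move=> w; rewrite sE => /ideal_genE [c ->].
  have /choice[d hd] (i : 'I_(size s)) : exists d, x ^+ (\max_i N i) * s`_i = d * y.
    have [d h] := hN i; exists (x ^+ (\max_i N i - N i) * d).
    by rewrite -mulrA -h mulrA -exprD subnK // leq_bigmax.
  exists (\sum_i c i * d i); rewrite mulr_sumr mulr_suml; apply: eq_bigr => i _.
  by rewrite mulrCA hd mulrA.
have [[p [q uE]]|[j [w [w' [q [_ ww' uE]]]]]] := expand_mod_param N u; last first.
  exfalso; apply: (nopow j.+1 (w' * (v - x * q))).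
  rewrite -mulrA mulrBl [v * y]mulrC -xu uE exprS -[LHS]mul1r -ww'; ring.
have Jp : J p.
  exists N.+1, (v - x * q); rewrite exprS mulrBl [v * y]mulrC -xu uE; ring.
have [c hc] := hN _ Jp.
by exists (c + q); rewrite uE [p * _]mulrC hc; ring.
Qed.

End TwoParameters.

(** A chain of three primes in R has a middle term P that is neither 0 nor m, and
[param_power_notin_principal] applies to P.  The roles of x and y are symmetric
there, and y = 0 or x = 0 would make a first power divisible by the other
parameter. *)
Lemma regular_local_regular_pair (R : idomainType) (m : set R) (x y : R) :
  regular_local m [tuple x; y] ->
  [/\ x != 0, y != 0 & regular_pair x y].
Proof.
move=> [noeth locm [[P [hP hPs]] _] mE].
have {}mE u : m u <-> exists p q, u = p * x + q * y by rewrite mE; apply: ideal_gen2E.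
have mE' u : m u <-> exists p q, u = p * y + q * x.
  by rewrite mE; split=> -[p [q ->]]; exists q, p; rewrite addrC.
have [z Pz z0] : exists2 z, P 1%N z & z != 0.
  have [_ /existsNP[z /not_implyP[Pz nz]]] := hPs 0%N isT.
  exists z => //; apply/eqP => z0; apply: nz; rewrite z0.
  by have [] := hP 0%N isT => h _ _; apply: ideal0.
have [w Pw nPw] : exists2 w, P 2%N w & ~ P 1%N w.
  by have [_ /existsNP[w /not_implyP[Pw nw]]] := hPs 1%N isT; exists w.
have mw : m w.
  apply: contrapT => /(notin_maximal_unit locm) [w' ww'].
  have [h + _] := hP 2%N isT; apply; rewrite -ww'; exact: ideal_mulr.
have pP := hP 1%N isT.
have nx := param_power_notin_principal locm noeth mE pP Pz z0 mw nPw.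
have ny := param_power_notin_principal locm noeth mE' pP Pz z0 mw nPw.
split.
- by apply/eqP => x0; apply: (nx 1%N 0); rewrite x0; ring.
- by apply/eqP => y0; apply: (ny 1%N 0); rewrite y0; ring.
- exact: param_regular locm noeth mE nx.
Qed.

(** * Consequences of the regular sequence *)

Section RegularPair.
Context (R : idomainType) (x y : R).
Local Notation toK := (@tofrac R).
Hypothesis (x0 : x != 0) (y0 : y != 0).
Hypothesis reg : regular_pair x y.

Lemma regular_pair_pow p q u v :
  x ^+ p * u = y ^+ q * v -> exists t, u = y ^+ q * t.
Proof.
have reg1 : forall p u v, x ^+ p * u = y * v -> exists t, u = y * t.
  elim=> [|{}p IH] {}u {}v; first by rewrite mul1r => ->; exists v.
  by rewrite exprS -mulrA => /reg [t /IH].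
elim: q u v => [|q IH] u v; first by exists u; rewrite mul1r.
rewrite exprS -mulrA => h; have [t ut] := reg1 _ _ _ h.
move: h; rewrite ut mulrCA => /(mulfI y0) /IH [s ->].
by exists s; rewrite mulrA.
Qed.

(** The depth argument: two fractions s / x^p and t / y^q that are equal lie in
R. *)
Lemma fraction_regular_denominators (f : {fraction R}) p q s t :
  toK (x ^+ p) * f = toK s -> toK (y ^+ q) * f = toK t -> Rsub f.
Proof.
move=> hs ht; have E : x ^+ p * t = y ^+ q * s.
  by apply/eqP; rewrite -tofrac_eq !tofracM -hs -ht mulrCA.
have [t' tE] := regular_pair_pow E.
exists t' => //; apply: (@mulfI _ (toK (y ^+ q))).
  by rewrite tofrac_eq0 expf_neq0.
by rewrite ht tE tofracM.
Qed.

End RegularPair.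

(** * Determinants as functions of their rows *)

Section SetRow.
Context (R : comNzRingType) (n : nat).
Implicit Types (D : 'M[R]_n) (u : 'rV[R]_n).

Definition set_row D k u : 'M[R]_n := \matrix_(i, j) if i == k then u 0 j else D i j.

Lemma det_set_row D k u : \det (set_row D k u) = \sum_j u 0 j * cofactor D k j.
Proof.
rewrite (expand_det_row _ k); apply: eq_bigr => j _; rewrite mxE eqxx.
congr (_ * (_ * \det _)); apply/matrixP => i j'; rewrite !mxE.
by rewrite eq_sym (negbTE (neq_lift _ _)).
Qed.

(** The determinant is linear in each row, so generators can be replaced by
elements of their span one row at a time. *)
Lemma det_mspan_rows (J : set R) (S : set 'rV[R]_n) : is_ideal J ->
  (forall D, (forall i, S (row i D)) -> J (\det D)) ->
  forall D, (forall i, mspan setT S (row i D)) -> J (\det D).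
Proof.
move=> hJ hS D hD.
suff H : forall k D, (forall i : 'I_n, (i < k)%N -> mspan setT S (row i D)) ->
    (forall i : 'I_n, (k <= i)%N -> S (row i D)) -> J (\det D).
  by apply: (H n) => // i; rewrite leqNgt ltn_ord.
elim=> [|k IH] {hD}D h1 h2; first by apply: hS => i; apply: h2.
have [kn|nk] := ltnP k n; last first.
  apply: IH => i hi; [exact: (h1 i (ltnW hi))|].
  by have := leq_trans nk hi; rewrite leqNgt ltn_ord.
pose k0 := Ordinal kn.
have -> : D = set_row D k0 (row k0 D).
  by apply/matrixP => i j; rewrite !mxE; case: eqP => // ->.
suff : mspan setT S `<=` [set u | J (\det (set_row D k0 u))].
  by apply; apply: h1 => /=.
have row_ne u i : i != k0 -> row i (set_row D k0 u) = row i D.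
  by move=> /negbTE ne; apply/rowP => j; rewrite !mxE ne.
have row_eq u : row k0 (set_row D k0 u) = u.
  by apply/rowP => j; rewrite !mxE eqxx.
apply: mspan_min; first split.
- rewrite /= det_set_row big1; first exact: ideal0.
  by move=> j _; rewrite mxE mul0r.
- move=> u v /=; rewrite !det_set_row => hu hv.
  under eq_bigr do rewrite mxE mulrDl.
  by rewrite big_split; apply: idealD.
- move=> c u _ /=; rewrite !det_set_row => hu.
  under eq_bigr do rewrite mxE -mulrA.
  by rewrite -mulr_sumr; apply: idealM.
move=> u Su; apply: IH => i hi.
  rewrite row_ne; first by apply: h1; apply: ltnW.
  by apply/eqP => ik; move: hi; rewrite ik ltnn.
have [->|ne] := eqVneq i k0; first by rewrite row_eq.
rewrite row_ne //; apply: h2; rewrite ltn_neqAle hi andbT.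
by apply: contra ne => /eqP ki; apply/eqP/val_inj.
Qed.

End SetRow.

(** * The linear form that kills the Koszul rows *)

Section Koszul.
Context (R : idomainType) (x y : R) (n : nat).
Implicit Types u : 'rV[R]_n.+1.

Definition koszul_row i : 'rV[R]_n.+1 := y *: eps R n.+1 i + x *: eps R n.+1 i.+1.

Definition koszul_form u : R := \sum_(k < n.+1) (- y) ^+ k * x ^+ (n - k) * u 0 k.

Lemma koszul_form0 : koszul_form 0 = 0.
Proof. by rewrite /koszul_form big1 // => k _; rewrite mxE mulr0. Qed.

Lemma koszul_formD u v : koszul_form (u + v) = koszul_form u + koszul_form v.
Proof. by rewrite -big_split; apply: eq_bigr => k _; rewrite mxE mulrDr. Qed.

Lemma koszul_formZ c u : koszul_form (c *: u) = c * koszul_form u.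
Proof. by rewrite mulr_sumr; apply: eq_bigr => k _; rewrite mxE mulrCA. Qed.

Lemma epsE k (j : 'I_n.+1) : eps R n.+1 k 0 j = (j.+1 == k)%:R.
Proof. by rewrite mxE. Qed.

Lemma sum_eps (F : 'I_n.+1 -> R) (k : 'I_n.+1) :
  \sum_j F j * eps R n.+1 k.+1 0 j = F k.
Proof.
rewrite (bigD1 k) //= epsE eqxx mulr1 big1 ?addr0 // => j jk.
by rewrite epsE eqSS (inj_eq val_inj) (negbTE jk) mulr0.
Qed.

Lemma koszul_form_eps k : (k <= n)%N ->
  koszul_form (eps R n.+1 k.+1) = (- y) ^+ k * x ^+ (n - k).
Proof.
move=> kn; pose k0 := Ordinal (kn : (k < n.+1)%N).
exact: (sum_eps (fun j => (- y) ^+ j * x ^+ (n - j)) k0).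
Qed.

Lemma koszul_form_row i : (1 <= i <= n)%N -> koszul_form (koszul_row i) = 0.
Proof.
case: i => // i /= lt; rewrite koszul_formD !koszul_formZ !koszul_form_eps //; last exact: ltnW.
by rewrite -(subnSK lt) !exprS; ring.
Qed.

(** The cofactors of the first row are found without expanding minors: the
determinant vanishes when u is one of the other rows, which relates
consecutive cofactors, and for the first basis vector the matrix is
triangular. *)
Lemma koszul_form_det u : x != 0 ->
  \det (set_row (\matrix_(i, j) koszul_row i 0 j) 0 u) = koszul_form u.
Proof.
move=> x0; set G := \matrix_(i, j) _.
have cof (k : 'I_n.+1) : \det (set_row G 0 (eps R n.+1 k.+1)) = cofactor G 0 k.
  by rewrite det_set_row -[RHS](sum_eps (cofactor G 0)); apply: eq_bigr => j _; rewrite mulrC.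
have cof0 : cofactor G 0 0 = x ^+ n.
  rewrite -cof det_trig; last first.
    apply/is_trig_mxP => i j ij; rewrite !mxE.
    have [i0|i0] := eqVneq i 0; rewrite !eqSS.
      by rewrite gtn_eqF //; move: ij; rewrite i0.
    by rewrite (gtn_eqF (leqW ij)) (gtn_eqF ij) !mulr0 addr0.
  rewrite big_ord_recl !mxE eqxx mul1r.
  under eq_bigr => i _ do rewrite !mxE eq_sym (negbTE (neq_lift _ _)) eqxx gtn_eqF // mulr0 add0r mulr1.
  by rewrite prodr_const card_ord.
have cofS k (kn : (k < n)%N) :
    x * cofactor G 0 (inord k.+1) = - y * cofactor G 0 (inord k).
  apply/eqP; rewrite mulNr -addr_eq0; apply/eqP.
  have : \det (set_row G 0 (koszul_row k.+1)) = 0.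
    apply: (@determinant_alternate _ _ _ 0 (inord k.+1)).
      by rewrite -(inj_eq val_inj) /= inordK.
    by move=> j; rewrite !mxE eqxx -(inj_eq val_inj) /= inordK.
  have h1 := sum_eps (cofactor G 0) (inord k); have h2 := sum_eps (cofactor G 0) (inord k.+1).
  rewrite !inordK ?ltnS // in h1 h2; last exact: ltnW.
  rewrite det_set_row => <-; rewrite -h1 -h2 !mulr_sumr -big_split.
  by apply: eq_bigr => j _; rewrite !mxE /=; ring.
have cofE k : (k <= n)%N -> cofactor G 0 (inord k) = (- y) ^+ k * x ^+ (n - k).
  elim: k => [|k IH] kn.
    rewrite subn0 mul1r -cof0; congr cofactor.
    by apply: val_inj; rewrite /= inordK.
  apply: (mulfI x0); rewrite cofS // IH; last exact: ltnW.
  by rewrite -(subnSK kn) !exprS; ring.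
rewrite det_set_row; apply: eq_bigr => k _.
have := cofE k; rewrite inord_val => -> //; last by rewrite -ltnS.
by rewrite mulrC.
Qed.

(** Induction on the number of leading zeros of u.  The first nonzero coordinate
u_k is divisible by y, because y divides x^(n-k) u_k, and subtracting a multiple
of the row k + 1 makes it vanish. *)
Lemma koszul_form_ker u (N : set 'rV[R]_n.+1) : y != 0 ->
  regular_pair x y ->
  is_submod setT N -> (forall i, (1 <= i <= n)%N -> N (koszul_row i)) ->
  koszul_form u = 0 -> N u.
Proof.
move=> y0 reg [N0 ND NZ] Nk.
suff H : forall l k u, (k + l = n)%N -> (forall j : 'I_n.+1, (j < k)%N -> u 0 j = 0) ->
    koszul_form u = 0 -> N u.
  by apply: (H n 0%N).
elim=> [|l IH] k {}u kl uk.
  rewrite addn0 in kl; rewrite /koszul_form (bigD1 ord_max) //= big1 ?addr0; last first.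
    move=> j jn; rewrite uk ?mulr0 // kl ltn_neqAle -ltnS ltn_ord andbT.
    by rewrite -[X in (_ != X)]/(nat_of_ord (@ord_max n)) (inj_eq val_inj).
  rewrite subnn mulr1 => /eqP; rewrite mulf_eq0 expf_eq0 oppr_eq0 (negbTE y0) andbF /= => /eqP un.
  suff -> : u = 0 by [].
  apply/rowP => j; rewrite mxE; have [jn|jn] := ltnP j n; first by apply: uk; rewrite kl.
  by rewrite -un; congr (u _ _); apply: val_inj; apply/eqP; rewrite eqn_leq jn -ltnS ltn_ord.
move=> u0; have kn : (k < n)%N by lia.
pose k0 := Ordinal (leqW kn : (k < n.+1)%N).
have [t ut] : exists t, u 0 k0 = y * t.
  pose v := \sum_(j < n.+1 | j != k0) (if (j < k)%N then 0 else (- y) ^+ (j - k.+1) * x ^+ (n - j) * u 0 j).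
  apply: (@regular_pair_pow _ _ _ y0 reg (n - k) 1 (u 0 k0) v); rewrite expr1.
  have : (- y) ^+ k * (x ^+ (n - k) * u 0 k0 - y * v) = 0.
    rewrite -u0 /koszul_form [RHS](bigD1 k0) //= mulrBr mulrA; congr (_ + _).
    rewrite /v !mulr_sumr -sumrN.
    apply: eq_bigr => j jk; case: ltnP => [jk'|kj].
      by rewrite uk // !mulr0 oppr0.
    have kj' : (k < j)%N by rewrite ltn_neqAle kj andbT; apply: contra jk => /eqP E; apply/eqP/val_inj.
    have -> : (- y) ^+ j = (- y) ^+ k * - y * (- y) ^+ (j - k.+1).
      by rewrite -exprSr -exprD subnKC.
    by ring.
  move/eqP; rewrite mulf_eq0 expf_eq0 oppr_eq0 (negbTE y0) andbF /= subr_eq0.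
  by move/eqP.
have -> : u = (u - t *: koszul_row k.+1) + t *: koszul_row k.+1 by rewrite subrK.
have Nt : N (t *: koszul_row k.+1) by apply: NZ => //; apply: Nk.
apply: ND => //; apply: (IH k.+1); first lia.
  move=> j; rewrite ltnS leq_eqVlt => /orP [/eqP jk|jk].
    rewrite !mxE !eqSS jk eqxx ltn_eqF // mulr1 mulr0 addr0.
    rewrite (_ : j = k0) ?ut; last by apply: val_inj.
    by rewrite mulrC subrr.
  rewrite !mxE !eqSS uk // (ltn_eqF jk) (ltn_eqF (leqW jk)).
  by rewrite !mulr0 addr0 mulr0 subrr.
by rewrite -scaleNr koszul_formD koszul_formZ koszul_form_row // mulr0 addr0.
Qed.

End Koszul.

(** * Staircases of exponents *)

Section Staircase.
Context (n d : nat) (a b : nat -> nat).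
Local Notation c k := (b (d + k)%N - k)%N.

Definition staircase : Prop :=
  [/\ forall i, (i < d + n)%N -> (a i.+1 < a i)%N, a (d + n)%N = 0%N, b 0%N = 0%N &
      forall i, (i < d + n)%N -> (b i < b i.+1)%N].

Hypothesis stair : staircase.

Lemma a_gap i j : (i <= j <= d + n)%N -> (a j + (j - i) <= a i)%N.
Proof.
have [a_decr _ _ b_incr] := stair.
case/andP => /subnKC <-; elim: (j - i)%N => [|l IH] h; first by rewrite addn0; lia.
have lt : (i + l < d + n)%N by lia.
by have := a_decr _ lt; have := IH (ltnW lt); rewrite -addnS; lia.
Qed.

Lemma b_gap i j : (i <= j <= d + n)%N -> (b i + (j - i) <= b j)%N.
Proof.
have [a_decr _ _ b_incr] := stair.
case/andP => /subnKC <-; elim: (j - i)%N => [|l IH] h; first by rewrite addn0; lia.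
have lt : (i + l < d + n)%N by lia.
by have := b_incr _ lt; have := IH (ltnW lt); rewrite -addnS; lia.
Qed.

Lemma c_mono i j : (i <= j <= n)%N -> (c i <= c j)%N.
Proof.
move=> h; have : (d + i <= d + j <= d + n)%N by lia.
by move/b_gap; lia.
Qed.

Lemma c_ge k : (k <= n)%N -> (d <= c k)%N.
Proof.
move=> h; have : (0 <= d + k <= d + n)%N by lia.
have [_ _ b_start _] := stair.
by move/b_gap; lia.
Qed.

Lemma c_addK k : (k <= n)%N -> (c k + k = b (d + k)%N)%N.
Proof.
move=> h; have : (0 <= d + k <= d + n)%N by lia.
have [_ _ b_start _] := stair.
by move/b_gap; lia.
Qed.

Lemma a_ge i : (i <= d)%N -> (n <= a i)%N.
Proof.
move=> h; have : (i <= d + n <= d + n)%N by lia.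
have [_ a_end _ _] := stair.
by move/a_gap; lia.
Qed.

End Staircase.

(** * The maximal minors of the module *)

Section Generators.
Context (R : idomainType) (x y : R) (n d : nat) (a b : nat -> nat).
Local Notation phi := (@koszul_form R x y n).
Local Notation kos := (@koszul_row R x y n).
Local Notation c k := (b (d + k)%N - k)%N.

Hypothesis (d_gt0 : (0 < d)%N) (stair : staircase n d a b).

Definition fgen i : 'rV[R]_n.+1 := (x ^+ (a i - n) * y ^+ b i) *: eps R n.+1 1.
Definition hgen k : 'rV[R]_n.+1 := y ^+ c k *: eps R n.+1 k.+1.

Definition gens : set 'rV[R]_n.+1 :=
  [set fgen i | i in [set i | (i <= d)%N]] `|`
  [set kos i | i in [set i | (1 <= i <= n)%N]] `|`
  [set hgen k | k in [set k | (1 <= k <= n)%N]].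

(** The module M(I;e) for e = n + 1 and r = d + n. *)
Definition modM : set 'rV[R]_n.+1 := mspan setT gens.

Lemma MmodE : Mmod x y (d + n)%N a b n.+1 = modM.
Proof.
by rewrite /Mmod /modM /gens subn1 /= (_ : d + n - n.+1 + 1 = d)%N //; lia.
Qed.

Lemma modM_submod : is_submod setT modM. Proof. exact: mspan_submod. Qed.

Lemma modM_fgen i : (i <= d)%N -> modM (fgen i).
Proof. by move=> h; apply: mspan_gen; left; left; exists i. Qed.
Lemma modM_kos i : (1 <= i <= n)%N -> modM (kos i).
Proof. by move=> h; apply: mspan_gen; left; right; exists i. Qed.
Lemma modM_hgen k : (1 <= k <= n)%N -> modM (hgen k).
Proof. by move=> h; apply: mspan_gen; right; exists k. Qed.

(** The ideal J of the introduction. *)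
Definition form_ideal : set R := [set phi u | u in modM].

Lemma form_ideal_ideal : is_ideal form_ideal.
Proof.
have [h0 hD hZ] := modM_submod; apply: mk_ideal.
- by exists 0 => //; rewrite koszul_form0.
- by move=> _ _ [u Mu <-] [v Mv <-]; exists (u + v); rewrite ?koszul_formD //; apply: hD.
- by move=> p _ [u Mu <-]; exists (p *: u); rewrite ?koszul_formZ //; apply: hZ.
Qed.

Lemma form_ideal_fgen i A B q : (i <= d)%N -> (a i <= A)%N -> (b i <= B)%N ->
  form_ideal (q * x ^+ A * y ^+ B).
Proof.
move=> id /subnK <- /subnK <-.
rewrite (_ : _ * _ = q * x ^+ (A - a i) * y ^+ (B - b i) * (x ^+ a i * y ^+ b i)); last first.
  by rewrite !exprD; ring.
apply: (idealM _ form_ideal_ideal); exists (fgen i); first exact: modM_fgen.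
rewrite koszul_formZ koszul_form_eps // mul1r subn0.
by rewrite -{2}(subnK (a_ge stair id)) exprD; ring.
Qed.

Lemma form_ideal_hgen k A B q : (1 <= k <= n)%N -> (n - k <= A)%N -> (b (d + k)%N <= B)%N ->
  form_ideal (q * x ^+ A * y ^+ B).
Proof.
move=> kn /subnK <- /subnK <-.
rewrite (_ : _ * _ = q * (-1) ^+ k * x ^+ (A - (n - k)) * y ^+ (B - b (d + k)%N) *
  ((-1) ^+ k * (x ^+ (n - k) * y ^+ b (d + k)%N))); last first.
  rewrite !exprD; set s := (-1) ^+ k.
  have ss : s * s = 1 by rewrite -expr2 sqrr_sign.
  by rewrite -[LHS]mul1r -ss; ring.
apply: (idealM _ form_ideal_ideal); exists (hgen k); first exact: modM_hgen.
rewrite koszul_formZ koszul_form_eps; last by case/andP: kn.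
rewrite -[in RHS](c_addK stair); last by case/andP: kn.
by rewrite [(- y) ^+ k]exprNn exprD; ring.
Qed.

Lemma eps_inord k v : (v <= n)%N -> eps R n.+1 k 0 (inord v) = (v.+1 == k)%:R.
Proof. by move=> h; rewrite mxE inordK. Qed.

Lemma fgen_entry i v : (v <= n)%N ->
  fgen i 0 (inord v) = if v == 0%N then x ^+ (a i - n) * y ^+ b i else 0.
Proof.
move=> h; rewrite mxE eps_inord // eqSS.
by case: eqP => _; rewrite ?mulr1 ?mulr0.
Qed.

Lemma kos_entry i v : (v <= n)%N ->
  kos i 0 (inord v) = if v.+1 == i then y else if v == i then x else 0.
Proof.
move=> h; rewrite !mxE inordK // eqSS.
case: (eqVneq v.+1 i) => [<-|_]; last by case: eqP => _; rewrite mulr0 add0r ?mulr1 ?mulr0.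
by rewrite ltn_eqF // mulr0 addr0 mulr1.
Qed.

Lemma hgen_entry k v : (v <= n)%N ->
  hgen k 0 (inord v) = if v == k then y ^+ c k else 0.
Proof.
move=> h; rewrite mxE eps_inord // eqSS.
by case: eqP => _; rewrite ?mulr1 ?mulr0.
Qed.

(** A Leibniz term of a determinant with distinct rows among the generators is a
product of the entries (rho v)_v, where rho v is the row used in column v. *)
Section DiagonalProducts.
Variable rho : nat -> 'rV[R]_n.+1.
Hypothesis rho_gens : forall v, (v <= n)%N -> gens (rho v).
Hypothesis rho_inj : forall v w, (v <= n)%N -> (w <= n)%N -> rho v = rho w -> v = w.

Let T v := \prod_(v <= w < n.+1) rho w 0 (inord w).

(** The product over the columns v, .., n.  Until some row h occurs, only the
entries x of the g_w are possible: the entry y of g_(w+1) in column w would need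
the same row as the entry x of g_(w+1) in column w + 1.  When h_v occurs it
contributes y^(c_v), which is the case k = v of the second alternative.  From
there on, an entry x lowers k by one, which is harmless as c is nondecreasing,
and an entry y or a further h raises the exponent of y by at least one. *)
Lemma diagonal_suffix v : (1 <= v <= n.+1)%N ->
  ((forall w, (v <= w <= n)%N -> rho w = kos w) /\ T v = x ^+ (n.+1 - v)) \/
  exists k q, (v <= k <= n)%N /\ T v = q * x ^+ (n - k) * y ^+ (k - v + c k).
Proof.
move=> vn; have [l] : exists l, (l + v = n.+1)%N by exists (n.+1 - v)%N; lia.
elim: l v vn => [|l IH] v vn lv.
  left; split=> [w|]; first by lia.
  by rewrite /T big_geq; [rewrite (_ : n.+1 - v = 0)%N //|]; lia.
have vlen : (v <= n)%N by lia.
have v_gt0 : (v == 0)%N = false by apply/negbTE; lia.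
have -> : T v = rho v 0 (inord v) * T v.+1 by rewrite /T big_ltn // ltnS.
have zero : exists k q, (v <= k <= n)%N /\ 0 = q * x ^+ (n - k) * y ^+ (k - v + c k).
  (* A zero entry fits the second alternative with the coefficient 0. *)
  by exists n, 0; rewrite vlen leqnn !mul0r.
have IHv := IH v.+1 ltac:(lia) ltac:(lia).
case: (rho_gens vlen) => [[[i _ rv]|[i /= ige rv]]|[k /= kge rv]].
- by right; rewrite -rv fgen_entry // v_gt0 mul0r.
- rewrite -rv kos_entry //; case: (eqVneq v.+1 i) => [vi|_].
    case: IHv => [[allX _]|[k [q [kv ->]]]].
      have /rho_inj : rho v = rho v.+1 by rewrite -rv -vi allX //; lia.
      by lia.
    right; exists k, q; split; first by lia.
    rewrite (_ : k - v + c k = (k - v.+1 + c k).+1)%N; last by lia.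
    by rewrite exprS; ring.
  case: (eqVneq v i) => [vi|_]; last by right; rewrite mul0r.
  case: IHv => [[allX ->]|[k [q [kv ->]]]].
    left; split; last by rewrite -exprS; congr (_ ^+ _); lia.
    move=> w; case: (eqVneq w v) => [-> _|wv h]; first by rewrite -rv vi.
    by apply: allX; lia.
  right; exists k.-1, (q * y ^+ (c k - c k.-1)); split; first by lia.
  rewrite (_ : n - k.-1 = (n - k).+1)%N; last by lia.
  have cm : (c k.-1 <= c k)%N by apply: (c_mono stair); lia.
  rewrite (_ : k - v.+1 + c k = (c k - c k.-1) + (k.-1 - v + c k.-1))%N; last by lia.
  by rewrite exprS exprD; ring.
- rewrite -rv hgen_entry //; case: (eqVneq v k) => [vk|_]; last by right; rewrite mul0r.
  case: IHv => [[_ ->]|[j [q [jv ->]]]].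
    right; exists v, 1; split; first by lia.
    by rewrite subnn add0n -vk mul1r mulrC subSS.
  right; exists j, (q * y ^+ (c k).-1); split; first by lia.
  have c1 : (0 < c k)%N by apply: leq_trans (c_ge stair _); lia.
  rewrite (_ : j - v + c j = (j - v.+1 + c j).+1)%N; last by lia.
  by rewrite -{1}(prednK c1) !exprS; ring.
Qed.

(** In column 0 the possible entries are those of f_i and the entry y of g_1. *)
Lemma diagonal_product : form_ideal (T 0%N).
Proof.
have -> : T 0%N = rho 0%N 0 (inord 0) * T 1%N by rewrite /T big_ltn.
have IH := @diagonal_suffix 1%N ltac:(lia).
case: (rho_gens (leq0n n)) => [[[i /= id r0]|[i /= ige r0]]|[k /= kge r0]].
- rewrite -r0 fgen_entry //=.
  have an := a_ge stair id.
  case: IH => [[_ ->]|[k [q [kn ->]]]].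
    rewrite subn1 /= (_ : _ * _ = 1 * x ^+ (a i - n + n) * y ^+ b i); last by rewrite exprD; ring.
    by apply: (@form_ideal_fgen i); lia.
  rewrite (_ : _ * _ = q * x ^+ (a i - n + (n - k)) * y ^+ (b i + (k - 1 + c k))); last first.
    by rewrite !exprD; ring.
  have ck1 : (c 1%N <= c k)%N by apply: (c_mono stair); lia.
  have cd : (b d <= c 1%N)%N by have := @c_mono _ _ _ _ stair 0%N 1%N ltac:(lia); rewrite addn0 subn0.
  have e1 := @c_addK _ _ _ _ stair 1%N ltac:(lia).
  have ai : (i < d -> a d < a i)%N.
    by move=> h; have : (i <= d <= d + n)%N by [lia]; move/(a_gap stair); lia.
  have bi : (0 < i -> 0 < b i)%N.
    by move=> h; have : (0 <= i <= d + n)%N by [lia]; move/(b_gap stair); lia.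
  (* The monomial x^(a_i - k) y^(b_i + k - 1 + c_k) is divisible by phi(f_d), by
     phi(h_1) or by phi(h_j) with j = n - (a_i - k), according to its exponent
     of x. *)
  have [h1|h1] := leqP (a d) (a i - n + (n - k))%N.
    by apply: (@form_ideal_fgen d) => //; lia.
  have [h2|h2] := leqP (n - 1)%N (a i - n + (n - k))%N.
    by apply: (@form_ideal_hgen 1%N); lia.
  have ad := a_ge stair (leqnn d).
  have [j jE] : exists j, (j + (a i - n + (n - k)) = n)%N.
    by exists (n - (a i - n + (n - k)))%N; lia.
  have cj : (c j <= c k)%N by apply: (c_mono stair); lia.
  have ej := @c_addK _ _ _ _ stair j ltac:(lia).
  by apply: (@form_ideal_hgen j); lia.
- rewrite -r0 kos_entry // (_ : (0 == i)%N = false); last by apply/negbTE; lia.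
  case: (eqVneq 1%N i) => [i1|_]; last by rewrite mul0r; apply: ideal0; apply: form_ideal_ideal.
  case: IH => [[allX _]|[k [q [kn ->]]]].
    have /rho_inj : rho 0%N = rho 1%N by rewrite -r0 -i1 allX //; lia.
    by lia.
  rewrite (_ : _ * _ = q * x ^+ (n - k) * y ^+ (k - 1 + c k).+1); last by rewrite exprS; ring.
  have ek := @c_addK _ _ _ _ stair k ltac:(lia).
  by apply: (@form_ideal_hgen k); lia.
- rewrite -r0 hgen_entry // (_ : (0 == k)%N = false); last by apply/negbTE; lia.
  by rewrite mul0r; apply: ideal0; apply: form_ideal_ideal.
Qed.

End DiagonalProducts.

(** Reduce to rows among the generators, which are distinct unless the
determinant vanishes, and treat each Leibniz term separately. *)
Lemma det_modM_rows (D : 'M[R]_n.+1) : (forall i, modM (row i D)) -> form_ideal (\det D).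
Proof.
apply: det_mspan_rows; first exact: form_ideal_ideal.
move=> {}D hD.
have [[i [j [ij Dij]]]|ninj] := pselect (exists i j, i != j /\ row i D = row j D).
  rewrite (determinant_alternate ij); first exact: (ideal0 form_ideal_ideal).
  by move=> k; have /rowP /(_ k) := Dij; rewrite !mxE.
apply: (ideal_sum form_ideal_ideal) => s; apply: (idealM _ form_ideal_ideal).
rewrite (reindex_inj (@perm_inj _ (s^-1)%g)) /=.
pose rho v := row ((s^-1)%g (inord v)) D.
have : form_ideal (\prod_(0 <= v < n.+1) rho v 0 (inord v)).
  apply: diagonal_product => [v _|v w vn wn vw]; first exact: hD.
  have : (s^-1)%g (inord v) = (s^-1)%g (inord w).
    by apply: contrapT => /eqP ne; apply: ninj; do 2!eexists; split; first exact: ne.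
  by move/perm_inj/(congr1 val); rewrite /= !inordK.
rewrite big_mkord; congr (form_ideal _); apply: eq_bigr => i _.
by rewrite /rho inord_val mxE permKV.
Qed.

Lemma form_ideal_det u : x != 0 -> modM u ->
  exists D : 'M[R]_n.+1, (forall i, modM (row i D)) /\ \det D = phi u.
Proof.
move=> x0 Mu; exists (set_row (\matrix_(i, j) kos i 0 j) 0 u).
split; last exact: koszul_form_det x0.
move=> i; have [->|i0] := eqVneq i 0.
  by rewrite (_ : row _ _ = u) //; apply/rowP => j; rewrite !mxE eqxx.
rewrite (_ : row _ _ = kos i); last by apply/rowP => j; rewrite 2!mxE (negbTE i0) mxE.
by apply: modM_kos; rewrite lt0n i0 -ltnS ltn_ord.
Qed.

End Generators.

(** * Submodules of finite colength, double duals and Fitting ideals *)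

Lemma scalemx_inj (R : idomainType) m n (c : R) (A B : 'M[R]_(m, n)) :
  c != 0 -> c *: A = c *: B -> A = B.
Proof.
move=> c0 /matrixP E; apply/matrixP => i j; apply: (mulfI c0).
by have := E i j; rewrite !mxE.
Qed.

Section LargeSubmodules.
Context (R : idomainType) (x y : R) (n : nat).
Local Notation toK := (@tofrac R).
Local Notation K := {fraction R}.
Local Notation e_ j := (delta_mx 0 j : 'rV_n).
Hypothesis (y0 : y != 0) (reg : regular_pair x y).

(** All that is needed of the finite length of R^n / N. *)
Definition large (N : set 'rV[R]_n) := exists p q, forall j : 'I_n,
  N (x ^+ p *: e_ j) /\ N (y ^+ q *: e_ j).

(** The coordinates of an element of the dual have denominators dividing a power
of x and a power of y. *)
Lemma dual_eq_lattice (N : set 'rV[R]_n) : large N ->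
  dual (extK N) = range (map_mx toK).
Proof.
move=> [p [q pq]]; apply/seteqP; split=> [f hf|_ [f _ <-] _ [u _ <-]].
  have coef (t : R) (j : 'I_n) : (f *m (map_mx toK (t *: e_ j))^T) 0 0 = toK t * f 0 j.
    rewrite mxE (bigD1 j) //= big1 => [|k kj].
      by rewrite !mxE !eqxx mulr1 addr0 mulrC.
    by rewrite !mxE (negbTE kj) andbF mulr0 tofrac0 mulr0.
  have fR j : Rsub (f 0 j).
    have [Nx Ny] := pq j.
    have [s _] : Rsub (toK (x ^+ p) * f 0 j) by rewrite -coef; apply: hf; exists (x ^+ p *: e_ j).
    have [t _] : Rsub (toK (y ^+ q) * f 0 j) by rewrite -coef; apply: hf; exists (y ^+ q *: e_ j).
    by move=> ht hs; apply: (fraction_regular_denominators y0 reg (esym hs) (esym ht)).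
  have /choice[g hg] (j : 'I_n) : exists t, toK t = f 0 j by have [t _ h] := fR j; exists t.
  by exists (\row_j g j) => //; apply/rowP => j; rewrite !mxE hg.
by exists ((f *m u^T) 0 0) => //; rewrite map_trmx -map_mxM [RHS]mxE.
Qed.

Lemma ddual_eq_lattice (N : set 'rV[R]_n) : large N -> ddual N = range (map_mx toK).
Proof.
move=> hN; rewrite /ddual dual_eq_lattice //; apply: (@dual_eq_lattice setT).
by exists 0%N, 0%N.
Qed.

Lemma mspan_Rsub_rows (k : nat) (B : 'M[K]_(k, n)) f :
  mspan (@Rsub R) (range (fun i => row i B)) f ->
  exists p : 'rV[R]_k, f = map_mx toK p *m B.
Proof.
apply: (@mspan_min _ _ _ _ [set f | exists p : 'rV[R]_k, f = map_mx toK p *m B]).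
  split=> [|_ _ [p ->] [p' ->]|_ _ [c _ <-] [p ->]].
  - by exists 0; rewrite map_mx0 mul0mx.
  - by exists (p + p'); rewrite map_mxD mulmxDl.
  - by exists (c *: p); rewrite map_mxZ scalemxAl.
by move=> _ [i _ <-]; exists (delta_mx 0 i); rewrite map_delta_mx -rowE.
Qed.

Lemma free_basis_lattice : free_basis 1%:M (range (map_mx toK) : set 'rV[K]_n).
Proof.
split; first exact: unitmx1.
apply/seteqP; split=> [_ [f _ <-]|f /mspan_Rsub_rows [p ->]]; last first.
  by exists p => //; rewrite mulmx1.
have hN := mspan_submod (@Rsub R) (range (fun i => row i (1%:M : 'M[K]_n))).
rewrite [map_mx _ _]row_sum_delta; apply: (submod_sum hN) => j.
have [_ _ NZ] := hN; apply: NZ; first by rewrite mxE; exists (f 0 j).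
by apply: mspan_gen; exists j => //; rewrite row1.
Qed.

Lemma IM_det (N : set 'rV[R]_n) (D : 'M[R]_n) : large N ->
  (forall i, N (row i D)) -> IM N (\det D).
Proof.
move=> hN hD; exists 1%:M.
  by rewrite ddual_eq_lattice //; apply: free_basis_lattice.
apply: (@mspan_gen R R^o); exists D => // i; rewrite mulmx1.
by exists (row i D) => //; rewrite map_row.
Qed.

(** Relations over an arbitrary basis B of N^** = R^n: the determinant of the
basis is a unit of R, because the standard basis is a combination of the rows
of B. *)
Lemma IM_sub (N : set 'rV[R]_n) (J : set R) : large N -> is_ideal J ->
  (forall D : 'M[R]_n, (forall i, N (row i D)) -> J (\det D)) -> IM N `<=` J.
Proof.
move=> hN hJ hdet s [B [_]]; rewrite ddual_eq_lattice // => BE; move: s.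
apply: (@mspan_min R R^o) => // _ [C hC <-].
have /choice[D hD] i : exists u, N u /\ map_mx toK u = row i (map_mx toK C *m B).
  by have [u Nu h] := hC i; exists u.
pose DM := \matrix_i D i.
have DME : map_mx toK DM = map_mx toK C *m B.
  by apply/row_matrixP => i; rewrite -map_row rowK; case: (hD i).
have /choice[P hP] (j : 'I_n) : exists p, map_mx toK (e_ j) = map_mx toK p *m B.
  by apply: mspan_Rsub_rows; rewrite -BE; exists (e_ j).
have PB : map_mx toK (\matrix_j P j) *m B = 1%:M.
  by apply/row_matrixP => j; rewrite row_mul -map_row rowK -hP map_delta_mx row1.
have -> : \det C = \det (\matrix_j P j) * \det DM.
  apply/eqP; rewrite -tofrac_eq tofracM -!det_map_mx DME det_mulmx mulrCA.
  by rewrite -det_mulmx PB det1 mulr1.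
apply: idealM => //; apply: hdet => i; rewrite rowK; by case: (hD i).
Qed.

(** Linear maps send the integral closure of a module into the integral closure
of its image. *)
Lemma int_closure_form (N : set 'rV[R]_n) (J : set R) (T : 'cV[R]_n) f :
  complete_ideal J -> (forall u, N u -> J ((u *m T) 0 0)) -> int_closure N f ->
  exists2 w, J w & (f *m map_mx toK T) 0 0 = toK w.
Proof.
move=> cJ NT [f1 f2].
pose J1 : set 'rV[R]_1 := [set u | J (u ord0 ord0)].
have push A : mspan A (extK N) f -> mspan A (extK J1) (f *m map_mx toK T).
  apply: (@mspan_linear _ _ _ _ (mulmxr (map_mx toK T))) => _ [u Nu <-] /=.
  by apply: mspan_gen; exists (u *m T); [apply: NT | rewrite map_mxM].
have : int_closure J1 (f *m map_mx toK T).
  by split; [apply: push | move=> V hV; apply: push; apply: f2].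
rewrite cJ => -[u Ju <-]; exists (u 0 0) => //; by rewrite mxE.
Qed.

(** The projection pr of N onto N1 satisfies
x^p pr(y^q e_j) = y^q pr(x^p e_j), so that y^q divides pr(y^q e_j); the quotients
are the rows of P. *)
Lemma projection_matrix (N N1 N2 : set 'rV[R]_n) : large N ->
  is_submod setT N1 -> is_submod setT N2 ->
  N = [set u + w | u in N1 & w in N2] -> N1 `&` N2 = [set 0] ->
  exists P : 'M[R]_n, [/\ P *m P = P, forall u, N u -> N (u *m P),
    forall u, N1 u -> u *m P = u & forall u, N2 u -> u *m P = 0].
Proof.
move=> [p [q pq]] S1 S2 NE N12.
have [Z1 D1 M1] := S1; have [Z2 D2 M2] := S2.
have B2 u v : N2 u -> N2 v -> N2 (u - v).
  by move=> h h'; apply: D2 => //; rewrite -scaleN1r; apply: M2.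
have B1 u v : N1 u -> N1 v -> N1 (u - v).
  by move=> h h'; apply: D1 => //; rewrite -scaleN1r; apply: M1.
have uniq u w w' : N1 w -> N2 (u - w) -> N1 w' -> N2 (u - w') -> w = w'.
  move=> h1 h2 h1' h2'; apply/eqP; rewrite -subr_eq0; apply/eqP.
  have : (N1 `&` N2) (w - w').
    split; first exact: B1.
    by rewrite (_ : w - w' = (u - w') - (u - w)); [apply: B2 | rewrite opprB [RHS]addrC addrA subrK].
  by rewrite N12.
have /choice[pr hpr] u : exists w, N u -> N1 w /\ N2 (u - w).
  have [|nNu] := pselect (N u); last by exists 0.
  by rewrite NE => -[v Nv [w Nw <-]]; exists v; rewrite addrC addrK.
have [Nx Ny] : (forall j, N (x ^+ p *: e_ j)) /\ (forall j, N (y ^+ q *: e_ j)).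
  by split=> j; case: (pq j).
have /choice[P hP] (j : 'I_n) : exists r : 'rV[R]_n, pr (y ^+ q *: e_ j) = y ^+ q *: r.
  have E : x ^+ p *: pr (y ^+ q *: e_ j) = y ^+ q *: pr (x ^+ p *: e_ j).
    have [a1 a2] := hpr _ (Nx j); have [b1 b2] := hpr _ (Ny j).
    apply: (@uniq (x ^+ p *: (y ^+ q *: e_ j))).
    - exact: M1.
    - by rewrite -scalerBr; apply: M2.
    - exact: M1.
    - by rewrite scalerA mulrC -scalerA -scalerBr; apply: M2.
  have /choice[r hr] (k : 'I_n) : exists t, pr (y ^+ q *: e_ j) 0 k = y ^+ q * t.
    by have /rowP/(_ k) := E; rewrite !mxE => /(regular_pair_pow y0 reg).
  by exists (\row_k r k); apply/rowP => k; rewrite !mxE hr.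
pose PM := \matrix_j P j.
have prE u : N u -> pr u = u *m PM.
  move=> Nu; have [u1 u2] := hpr _ Nu.
  suff E : y ^+ q *: pr u = y ^+ q *: (u *m PM).
    exact: scalemx_inj (expf_neq0 q y0) E.
  have -> : y ^+ q *: (u *m PM) = \sum_j u 0 j *: pr (y ^+ q *: e_ j).
    rewrite mulmx_sum_row scaler_sumr; apply: eq_bigr => j _.
    by rewrite rowK hP scalerA mulrC -scalerA.
  apply: (@uniq (y ^+ q *: u)); first exact: M1.
  - by rewrite -scalerBr; apply: M2.
  - by apply: (submod_sum S1) => j; apply: M1 => //; case: (hpr _ (Ny j)).
  rewrite [u in X in N2 (X - _)]row_sum_delta scaler_sumr -sumrB.
  apply: (submod_sum S2) => j; rewrite scalerA mulrC -scalerA -scalerBr.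
  by apply: M2 => //; case: (hpr _ (Ny j)).
have N1N u : N1 u -> N u by move=> h; rewrite NE; exists u => //; exists 0; rewrite ?addr0.
have N2N u : N2 u -> N u by move=> h; rewrite NE; exists 0 => //; exists u; rewrite ?add0r.
have fix1 u : N1 u -> u *m PM = u.
  move=> h; rewrite -prE; last exact: N1N.
  by have [h1 h2] := hpr _ (N1N _ h); apply: (@uniq u) => //; rewrite subrr.
have img u : N u -> N1 (u *m PM) by move=> h; rewrite -prE //; case: (hpr _ h).
exists PM; split => // [|u Nu|u h]; last 1 first.
- rewrite -prE; last exact: N2N.
  have [h1 h2] := hpr _ (N2N _ h); apply: (@uniq u) => //; by rewrite subr0.
- apply/row_matrixP => j; rewrite row_mul rowK.
  have := fix1 _ (img _ (Ny j)); rewrite -!scalemxAl -rowE rowK.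
  exact: scalemx_inj (expf_neq0 q y0).
- by apply: N1N; apply: img.
Qed.

End LargeSubmodules.

Lemma mulmx_local_eq0 (R : comNzRingType) (m : set R) (n : nat) (A C : 'M[R]_n) :
  local_ring m -> (forall i j, m (C i j)) -> A *m (1%:M - C) = 0 -> A = 0.
Proof.
move=> hm hC AC; have [w hw] := det1B_unit hm hC.
have : A *m (1%:M - C) *m \adj (1%:M - C) = 0 by rewrite AC mul0mx.
rewrite -mulmxA mul_mx_adj mul_mx_scalar => h.
by rewrite -[A]scale1r -hw mulrC -scalerA h scaler0.
Qed.

(** The scalar is idempotent modulo m, hence 0 or 1 there, since R/m is a field.
So P or 1 - P has its entries in m, and the other one is invertible. *)
Lemma idempotent_scalar_mod (R : comNzRingType) (m : set R) (n : nat)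
    (P : 'M[R]_n.+1) :
  local_ring m -> P *m P = P -> (forall i j, m (P i j - P 0 0 *+ (i == j))) ->
  P = 0 \/ P = 1%:M.
Proof.
move=> hm PP Pm; have [[im m1 _] _] := hm.
have P00 : m (P 0 0 * (1 - P 0 0)).
  have E : P 0 0 = \sum_j P 0 j * P j 0 by rewrite -{1}PP mxE.
  rewrite mulrBr mulr1 {1}E (bigD1 0) //= addrAC subrr add0r.
  rewrite big_mkcond; apply: (ideal_sum im) => j; case: eqP => [_|/eqP j0] /=; first exact: ideal0.
  by apply: ideal_mulr => //; have := Pm 0 j; rewrite eq_sym (negbTE j0) subr0.
have [mP|nmP] := pselect (m (P 0 0)).
  left; apply: (mulmx_local_eq0 (C := P) hm); last by rewrite mulmxBr mulmx1 PP subrr.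
  move=> i j; rewrite -(subrK (P 0 0 *+ (i == j)) (P i j)); apply: idealD => //.
  by case: eqP => _; rewrite ?mulr1n ?mulr0n //; apply: ideal0.
right; apply/esym/eqP; rewrite -subr_eq0; apply/eqP.
have [w hw] := notin_maximal_unit hm nmP.
have m1P : m (1 - P 0 0).
  rewrite (_ : 1 - _ = w * (P 0 0 * (1 - P 0 0))); first exact: idealM.
  by rewrite mulrA [w * _]mulrC hw mul1r.
apply: (mulmx_local_eq0 (C := 1%:M - P) hm); last first.
  by rewrite opprB addrCA subrr addr0 mulmxBl mul1mx PP subrr.
move=> i j; rewrite !mxE.
rewrite (_ : _ - _ = (1 - P 0 0) *+ (i == j) - (P i j - P 0 0 *+ (i == j))).
  apply: idealB => //; case: eqP => _; rewrite ?mulr1n ?mulr0n //; exact: ideal0.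
by case: eqP => _; rewrite ?mulr1n ?mulr0n; ring.
Qed.

(** * The square of the maximal ideal *)

Section SquareOfMaximal.
Context (R : idomainType) (m : set R) (x y : R).
Hypothesis (y0 : y != 0) (reg : regular_pair x y).
Hypothesis im : is_ideal m.
Hypothesis (mx : m x) (my : m y).

Definition msquare : set R :=
  [set u | exists p q s, u = p * x ^+ 2 + q * (x * y) + s * y ^+ 2].

Lemma msquare_ideal : is_ideal msquare.
Proof.
apply: mk_ideal.
- by exists 0, 0, 0; ring.
- move=> _ _ [p [q [s ->]]] [p' [q' [s' ->]]].
  by exists (p + p'), (q + q'), (s + s'); ring.
- by move=> c _ [p [q [s ->]]]; exists (c * p), (c * q), (c * s); ring.
Qed.

Lemma msquare_monomial A B : (2 <= A + B)%N -> msquare (x ^+ A * y ^+ B).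
Proof.
case: A => [|[|A]]; last by exists (x ^+ A * y ^+ B), 0, 0; rewrite !exprS; ring.
  by case: B => [|[|B]] // _; exists 0, 0, (y ^+ B); rewrite !exprS; ring.
by case: B => [|B] // _; exists 0, (y ^+ B), 0; rewrite !exprS; ring.
Qed.

(** The classes of x and y are independent in m/m^2: this follows from the
regular sequence after grouping the terms divisible by x and by y. *)
Lemma msquare_linear u v : msquare (y * v + x * u) -> m u /\ m v.
Proof.
move=> [p [q [s E]]].
have [t ut] : exists t, u - p * x = y * t.
  apply: (@reg _ (q * x + s * y - v)); rewrite mulrBr.
  by apply/eqP; rewrite subr_eq -subr_eq0 -(subrr (y * v + x * u)) {2}E; apply/eqP; ring.
have uE : u = p * x + y * t by rewrite -ut; ring.
have vE : v = q * x + s * y - x * t.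
  apply: (mulfI y0); apply: (@addIr _ (x * u)); rewrite E uE; ring.
split; first by rewrite uE; apply: idealD => //; [apply: idealM | apply: ideal_mulr].
rewrite vE; apply: idealB => //; last exact: ideal_mulr.
by apply: idealD => //; apply: idealM.
Qed.

End SquareOfMaximal.

(** * The module is integrally closed and indecomposable *)

Section MainModule.
Context (R : idomainType) (m : set R) (x y : R) (n d : nat) (a b : nat -> nat).
Local Notation toK := (@tofrac R).
Local Notation phi := (@koszul_form R x y n).
Local Notation kos := (@koszul_row R x y n).
Local Notation c k := (b (d + k)%N - k)%N.
Local Notation M := (@modM R x y n d a b).
Local Notation J := (@form_ideal R x y n d a b).

Hypothesis (x0 : x != 0) (y0 : y != 0) (reg : regular_pair x y).
Hypothesis (n_gt0 : (0 < n)%N) (d_gt1 : (1 < d)%N).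
Hypothesis stair : staircase n d a b.

Let d_gt0 : (0 < d)%N. Proof. exact: ltnW. Qed.
Let b_start : b 0%N = 0%N. Proof. by case: stair. Qed.

(** Modulo M, x times a basis vector is minus y times the previous one. *)
Lemma modM_x_eps k : (k <= n)%N -> M (x ^+ (a 0%N - n + k) *: eps R n.+1 k.+1).
Proof.
have [Z D S] := modM_submod x y n d a b.
elim: k => [|k IH] kn.
  rewrite addn0 (_ : _ *: _ = fgen x y n a b 0); first exact: modM_fgen.
  by rewrite /fgen b_start mulr1.
rewrite (_ : _ *: _ = x ^+ (a 0%N - n + k) *: kos k.+1 -
   y *: (x ^+ (a 0%N - n + k) *: eps R n.+1 k.+1)).
  apply: D; first by apply: S => //; apply: modM_kos.
  by rewrite -scaleNr; apply: S => //; apply: IH; apply: ltnW.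
by rewrite addnS exprSr scalerDr !scalerA [y * _]mulrC addrAC subrr add0r.
Qed.

Lemma modM_y_eps k : (k <= n)%N -> M (y ^+ (c n).+1 *: eps R n.+1 k.+1).
Proof.
have [Z D S] := modM_submod x y n d a b.
have pos j : (1 <= j <= n)%N -> forall p, M (y ^+ (c n + p) *: eps R n.+1 j.+1).
  move=> jn p; have cm : (c j <= c n)%N by apply: (c_mono stair); lia.
  rewrite (_ : c n + p = (c n - c j + p) + c j)%N; last by lia.
  by rewrite exprD -scalerA; apply: S => //; apply: modM_hgen.
case: k => [_|k kn]; last by rewrite -[(c n).+1]addn1; apply: pos.
rewrite (_ : _ *: _ = y ^+ c n *: kos 1 - x *: (y ^+ (c n + 0) *: eps R n.+1 2)).
  apply: D; first by apply: S => //; apply: modM_kos.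
  by rewrite -scaleNr; apply: S => //; apply: pos.
by rewrite addn0 exprSr scalerDr !scalerA [x * _]mulrC addrK.
Qed.

Lemma delta_eps (j : 'I_n.+1) : delta_mx 0 j = eps R n.+1 j.+1.
Proof. by apply/rowP => k; rewrite !mxE eqxx eqSS. Qed.

Lemma modM_large : large x y M.
Proof.
exists (a 0%N - n + n)%N, (c n).+1 => j; rewrite delta_eps.
have jn : (j <= n)%N by rewrite -ltnS.
split; last exact: modM_y_eps.
have [Z D S] := modM_submod x y n d a b.
rewrite (_ : a 0%N - n + n = n - j + (a 0%N - n + j))%N; last by lia.
by rewrite exprD -scalerA; apply: S => //; apply: modM_x_eps.
Qed.

Lemma IM_modM : IM M = J.
Proof.
apply/seteqP; split.
  apply: (IM_sub y0 reg modM_large (form_ideal_ideal _ _ _ _ _ _)) => D.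
  exact: det_modM_rows.
move=> _ [u Mu <-]; have [D [MD <-]] := form_ideal_det x0 Mu.
exact: (IM_det y0 reg modM_large).
Qed.

(** M contains the kernel of phi, so it is a full preimage. *)
Lemma modM_form_ideal u : J (phi u) -> M u.
Proof.
move=> [w Mw wu]; have [Z D S] := modM_submod x y n d a b.
rewrite -(subrK w u); apply: D => //.
apply: (koszul_form_ker y0 reg (modM_submod x y n d a b)).
  by move=> i; apply: modM_kos.
by rewrite koszul_formD -scaleN1r koszul_formZ wu; ring.
Qed.

Lemma modM_integrally_closed : complete_ideal J -> integrally_closed M.
Proof.
move=> cJ; have iJ := form_ideal_ideal x y n d a b.
apply/seteqP; split; last first.
  by move=> f Mf; split=> [|V _]; apply: mspan_gen.
move=> f hf.
have coord p (j : 'I_n.+1) : J p -> exists w, toK p * f 0 j = toK w.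
  move=> Jp; have [|w _ hw] := @int_closure_form _ _ M J (p *: delta_mx j 0) f cJ _ hf.
    move=> u _; rewrite -scalemxAr -colE !mxE; exact: ideal_mulr.
  by exists w; rewrite -hw map_mxZ map_delta_mx -scalemxAr -colE !mxE.
have Rf j : Rsub (f 0 j).
  have [] := @coord (x ^+ a 0%N) j.
    rewrite -[x ^+ _]mul1r -[_ * _]mulr1 -(expr0 y).
    by apply: (@form_ideal_fgen _ _ _ _ _ _ _ stair 0) => //; rewrite b_start.
  move=> s hs; have [] := @coord (y ^+ b (d + n)%N) j.
    rewrite -[y ^+ _]mul1r -[1 in X in J X](mulr1 1) -{2}(expr0 x).
    by apply: (@form_ideal_hgen _ _ _ _ _ _ _ stair n) => //; lia.
  by move=> t ht; exact: (fraction_regular_denominators y0 reg hs ht).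
have /choice[g hg] (j : 'I_n.+1) : exists t, toK t = f 0 j.
  by have [t _ h] := Rf j; exists t.
have fE : f = map_mx toK (\row_j g j) by apply/rowP => j; rewrite !mxE hg.
exists (\row_j g j) => //; apply: modM_form_ideal.
pose T : 'cV[R]_n.+1 := \col_k ((- y) ^+ k * x ^+ (n - k)).
have phiT u : (u *m T) 0 0 = phi u.
  by rewrite mxE; apply: eq_bigr => k _; rewrite mxE mulrC.
have [|w Jw hw] := @int_closure_form _ _ M J T f cJ _ hf.
  by move=> u Mu; rewrite phiT; exists u.
suff -> : phi (\row_j g j) = w by [].
apply/eqP; rewrite -tofrac_eq -hw fE -map_mxM [X in _ == X]mxE phiT; exact: eqxx.
Qed.

Section ModuloSquare.
Hypothesis lm : local_ring m.
Hypothesis (mx : m x) (my : m y).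

(** An element of M is congruent to sum_k al_k g_k modulo m^2 R^e, because the
other generators have degree at least d >= 2.  The conventions al_0 = al_(n+1) = 0
give the same formula for all coordinates. *)
Lemma modM_mod_square u0 : M u0 -> exists al : nat -> R, [/\ al 0%N = 0, al n.+1 = 0 &
  forall j : 'I_n.+1, msquare x y (u0 0 j - (y * al j.+1 + x * al j))].
Proof.
have isq := msquare_ideal x y.
apply: (@mspan_min _ _ _ _ [set u : 'rV[R]_n.+1 | exists al : nat -> R,
  [/\ al 0%N = 0, al n.+1 = 0 &
  forall j : 'I_n.+1, msquare x y (u 0 j - (y * al j.+1 + x * al j))]]).
  split.
  - exists (fun=> 0); split => // j; rewrite mxE !mulr0 addr0 subr0; exact: ideal0.
  - move=> u v [al [a0 an ha]] [be [b0 bn hb]]; exists (fun k => al k + be k).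
    split=> [||j]; rewrite ?a0 ?b0 ?an ?bn ?addr0 // mxE.
    rewrite (_ : _ - _ = (u 0 j - (y * al j.+1 + x * al j)) + (v 0 j - (y * be j.+1 + x * be j))).
      exact: idealD.
    by ring.
  - move=> p u _ [al [a0 an ha]]; exists (fun k => p * al k).
    split=> [||j]; rewrite ?a0 ?an ?mulr0 // mxE.
    rewrite (_ : _ - _ = p * (u 0 j - (y * al j.+1 + x * al j))); last by ring.
    exact: idealM.
move=> _ [[[i /= id <-]|[i /= ige <-]]|[k /= kge <-]].
- exists (fun=> 0); split=> // j; rewrite mxE !mulr0 addr0 subr0; apply: ideal_mulr => //.
  apply: msquare_monomial.
  have : (i <= d + n <= d + n)%N by lia.
  move/(a_gap stair); have : (0 <= i <= d + n)%N by lia.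
  by move/(b_gap stair); lia.
- exists (fun k => (k == i)%:R); split=> [||j].
  + by rewrite ltn_eqF //; lia.
  + by rewrite gtn_eqF //; lia.
  + by rewrite !mxE eqSS subrr; apply: ideal0.
- exists (fun=> 0); split=> // j; rewrite mxE !mulr0 addr0 subr0; apply: ideal_mulr => //.
  rewrite -[_ ^+ _]mul1r -(expr0 x); apply: msquare_monomial.
  by have := @c_ge _ _ _ _ stair k; lia.
Qed.

(** Comparing the coefficients of x and y in g_(i+1) P modulo m^2 gives, for the
rows i and i + 1 of P, one and the same sequence al modulo m up to a shift by one
column.  So P is constant modulo m along the diagonals; each diagonal other than
the main one ends in the first or the last column, at an entry that is al_0 or
al_(n+1), hence 0. *)
Lemma modM_endomorphism_scalar (P : 'M[R]_n.+1) : (forall u, M u -> M (u *m P)) ->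
  forall i j, m (P i j - P 0 0 *+ (i == j)).
Proof.
move=> hP; have [[im _ _] _] := lm.
pose p i j := P (inord i) (inord j).
have al i : (i < n)%N -> exists al : nat -> R, [/\ al 0%N = 0, al n.+1 = 0 &
    forall j, (j <= n)%N -> m (p i.+1 j - al j) /\ m (p i j - al j.+1)].
  move=> lt; have Mk : M (kos i.+1) by apply: modM_kos.
  have [al [a0 an h]] := modM_mod_square (hP _ Mk).
  exists al; split => // j jn; apply: (msquare_linear y0 reg im mx my).
  have := h (inord j); rewrite inordK // mulmxDl -!scalemxAl.
  have -> : eps R n.+1 i.+1 = delta_mx 0 (inord i) by rewrite delta_eps inordK // ltnW.
  have -> : eps R n.+1 i.+2 = delta_mx 0 (inord i.+1) by rewrite delta_eps inordK.
  rewrite -!rowE !mxE; congr (msquare _ _ _); rewrite /p; ring.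
have toep i j : (i < n)%N -> (j < n)%N -> m (p i.+1 j.+1 - p i j).
  move=> hi hj; have [be [_ _ h]] := al i hi.
  have [h1 _] := h j.+1 hj; have [_ h2] := h j (ltnW hj).
  rewrite (_ : _ - _ = (p i.+1 j.+1 - be j.+1) - (p i j - be j.+1)); last by ring.
  exact: idealB.
have col0 i : (i < n)%N -> m (p i.+1 0%N).
  by move=> /al [be [b0 _ h]]; have [+ _] := h 0%N isT; rewrite b0 subr0.
have coln i : (i < n)%N -> m (p i n).
  by move=> /al [be [_ bn h]]; have [_ +] := h n (leqnn n); rewrite bn subr0.
have shift l i j : (i + l <= n)%N -> (j + l <= n)%N -> m (p (i + l)%N (j + l)%N - p i j).
  elim: l => [|l IH] hi hj; first by rewrite !addn0 subrr; apply: ideal0.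
  rewrite !addnS in hi hj *.
  rewrite -(subrK (p (i + l)%N (j + l)%N) (p _.+1 _)) -addrA.
  by apply: idealD => //; [apply: toep | apply: IH; apply: ltnW].
have main i j : (i <= n)%N -> (j <= n)%N -> m (p i j - p 0%N 0%N *+ (i == j)).
  move=> hi hj; case: (ltngtP i j) => [ij|ji|<-]; rewrite ?mulr0n ?subr0 ?mulr1n.
  - have hin : (i + (n - j) < n)%N by lia.
    have := shift (n - j)%N i j ltac:(lia) ltac:(lia); rewrite subnKC // => h.
    by have := idealB im (coln _ hin) h; rewrite opprB addrCA subrr addr0.
  - have := shift j (i - j)%N 0%N ltac:(lia) ltac:(lia); rewrite subnK 1?ltnW // add0n => h.
    have := col0 (i - j).-1 ltac:(lia); rewrite prednK; last by lia.
    by move=> h'; have := idealD im h h'; rewrite subrK.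
  - exact: (shift i 0%N 0%N).
move=> i j; have := main i j (leq_ord i) (leq_ord j).
rewrite /p !inord_val (_ : inord 0 = 0 :> 'I_n.+1) ?(inj_eq val_inj) //.
by apply: val_inj; rewrite /= inordK.
Qed.

Lemma modM_indecomposable : indecomposable M.
Proof.
split.
  move=> M0; have [p [q /(_ 0) [h _]]] := modM_large; move: h; rewrite M0 => /= /rowP /(_ 0).
  by rewrite !mxE !eqxx mulr1 => /eqP; rewrite expf_eq0 (negbTE x0) andbF.
move=> N1 N2 S1 S2 NE N12.
have [P [PP hP P1 P2]] := projection_matrix y0 reg modM_large S1 S2 NE N12.
have zero (N : set 'rV[R]_n.+1) : is_submod setT N -> (forall u, N u -> u = 0) -> N = [set 0].
  by move=> [N0 _ _] h; apply/seteqP; split => [u /h ->|u ->].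
have [P0|P1E] := idempotent_scalar_mod lm PP (modM_endomorphism_scalar hP).
  by left; apply: zero => // u /P1; rewrite P0 mulmx0.
by right; apply: zero => // u /P2; rewrite P1E mulmx1.
Qed.

End ModuloSquare.
End MainModule.

Theorem theorem5p2 (R : idomainType) (m : set R) (x y : R)
    (hR : regular_local m [tuple x; y])
    (hres : infinite_residue_field m)
    (r : nat) (a b : nat -> nat)
    (hr : (2 <= r)%N)
    (ha : forall i : nat, (i < r)%N -> (a i.+1 < a i)%N)
    (har : a r = 0%N)
    (hb0 : b 0%N = 0%N)
    (hb : forall i : nat, (i < r)%N -> (b i < b i.+1)%N)
    (hab : (a 0%N <= b r)%N)
    (e : nat) (he : (2 <= e <= r - 1)%N)
    (hI : complete_ideal (IM (Mmod x y r a b e))) :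
  indecomposable (Mmod x y r a b e) /\ integrally_closed (Mmod x y r a b e).
Proof.
have [x0 y0 reg] := regular_local_regular_pair hR.
have [_ lm _ mE] := hR.
have mx : m x by rewrite mE; apply/ideal_gen2E; exists 1, 0; ring.
have my : m y by rewrite mE; apply/ideal_gen2E; exists 0, 1; ring.
case: e he hI => // n he.
have [d rE] : exists d, r = (d + n)%N by exists (r - n)%N; lia.
subst r; have d_gt1 : (1 < d)%N by lia.
have stair : staircase n d a b by split.
rewrite MmodE ?(ltnW d_gt1) // (IM_modM x0 y0 reg _ d_gt1 stair) //; last by lia.
move=> cJ; split.
  by apply: (modM_indecomposable x0 y0 reg _ d_gt1 stair lm mx my); lia.
by apply: (modM_integrally_closed x0 y0 reg _ d_gt1 stair cJ); lia.
Qed.
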